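(* Let $n$ be a positive integer and $\vec{x}=(x_1,\dots,x_n)\in\mathbb{Z}^n$. Then $$\vec{x}\cdot VBD_n=\{\vec{y}\in\mathbb{Z}^n\mid \mathrm{tr}(\vec{x})=\mathrm{tr}(\vec{y})\}.$$ Moreover, $\vec{x}\cdot IVBD_n=\vec{x}\cdot VBD_n$.
   Context: A virtual braid diagram of degree $n$ consists of $n$ strands in $\mathbb{R}^2$, each running monotonically from a top horizontal bar to a bottom horizontal bar, whose crossings are positive crossings $\sigma_i$, negative crossings $\sigma_i^{-1}$ or virtual crossings $v_i$ ($1\le i\le n-1$) between the strands in positions $i$ and $i+1$. Diagrams are considered up to planar isotopy fixing the bars pointwise. Equivalently, a diagram is a finite word (read top to bottom) in the letters $\sigma_i,\sigma_i^{-1},v_i$, where words are identified only via exchanging adjacent letters whose indices differ by at least $2$ (no other relations; $\sigma_i\sigma_i^{-1}$ and $v_iv_i$ are not trivial). $VBD_n$ is the monoid of all virtual braid diagrams of degree $n$; the product $b_1b_2$ is $b_1$ placed above $b_2$, and the identity is the diagram without crossings. Up-down action: integers $x_1,\dots,x_n$ are put on the top ends of the strands from left to right; following each strand downward, the integer increases by $1$ at each over-crossing, decreases by $1$ at each under-crossing, and is unchanged at virtual crossings. The tuple read at the bottom from left to right is $\vec{x}\cdot\beta$. In $\sigma_i$ the strand going from position $i+1$ to position $i$ is over; in $\sigma_i^{-1}$ the strand going from position $i$ to position $i+1$ is over. Thus $\vec{x}\cdot\sigma_i^{\pm1}$ is obtained from $\vec{x}$ by replacing the $i$-th and $(i+1)$-th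 components by $x_{i+1}\pm1$ and $x_i\mp1$, respectively; $\vec{x}\cdot v_i$ exchanges the $i$-th and $(i+1)$-th components; and $\vec{x}\cdot(b_1b_2)=(\vec{x}\cdot b_1)\cdot b_2$. For a subset $N\subseteq VBD_n$, $\vec{x}\cdot N=\{\vec{x}\cdot\beta\mid\beta\in N\}$. A diagram is irreducible if it has no non-alternating bigon, i.e. it is not represented by any word containing $\sigma_i\sigma_i^{-1}$ or $\sigma_i^{-1}\sigma_i$ as consecutive letters for some $i$. $IVBD_n\subseteq VBD_n$ is the set of irreducible virtual braid diagrams. $\mathrm{tr}(\vec{x})=\sum_{i=1}^n x_i$. *)

(* Defs.v *)
From HB Require Import structures.
From Stdlib Require Import Relation_Operators.
From mathcomp Require Import all_boot all_order all_algebra.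
From mathcomp Require Import boolp classical_sets.

Set Implicit Arguments.
Unset Strict Implicit.
Unset Printing Implicit Defensive.

Import GRing.Theory.
Local Open Scope ring_scope.
Local Open Scope quotient_scope.

Inductive crossing := Positive | Negative | Virtual.

Definition crossing_code (c : crossing) : option bool :=
  match c with
  | Positive => Some true | Negative => Some false | Virtual => None
  end.

Definition crossing_decode (o : option bool) : crossing :=
  match o with
  | Some true => Positive | Some false => Negative | None => Virtual
  end.

Lemma crossing_codeK : cancel crossing_code crossing_decode.
Proof. by case. Qed.

HB.instance Definition _ := Finite.copy crossing (can_type crossing_codeK).

(* The letter (i, c) is a crossing of kind c between the strands in the
   (0-based) positions i and i.+1; there are n.-1 such pairs of positions. *)
Definition letter (n : nat) := ('I_n.-1 * crossing)%type.

Definition word (n : nat) := seq (letter n).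

HB.instance Definition _ n := Choice.on (word n).

Definition far (n : nat) (a b : letter n) : bool :=
  (a.1.+1 < b.1)%N || (b.1.+1 < a.1)%N.

Inductive exchange (n : nat) : word n -> word n -> Prop :=
  Exchange (u v : word n) (a b : letter n) :
    far a b -> exchange (u ++ [:: a; b] ++ v) (u ++ [:: b; a] ++ v).

Definition isotopic (n : nat) : rel (word n) :=
  fun w1 w2 => `[< clos_refl_sym_trans (word n) (@exchange n) w1 w2 >].

Lemma isotopic_refl n : reflexive (@isotopic n).
Proof. by move=> w; apply/asboolP/rst_refl. Qed.

Lemma isotopic_sym n : symmetric (@isotopic n).
Proof.
by move=> u v; apply/idP/idP => /asboolP h; apply/asboolP/rst_sym.
Qed.

Lemma isotopic_trans n : transitive (@isotopic n).
Proof.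
by move=> v u w /asboolP h1 /asboolP h2; apply/asboolP/(rst_trans _ _ _ v).
Qed.

Canonical isotopic_equiv n :=
  EquivRel (@isotopic n) (@isotopic_refl n) (@isotopic_sym n)
           (@isotopic_trans n).

Definition VBD (n : nat) := {eq_quot @isotopic n}.

HB.instance Definition _ n := Choice.on (VBD n).
HB.instance Definition _ n := EqQuotient.on (VBD n).

Definition diagram (n : nat) (w : word n) : VBD n := \pi_(VBD n) w.

Lemma diagramP n (w1 w2 : word n) :
  reflect (diagram w1 = diagram w2) (isotopic w1 w2).
Proof. exact: (iffP (eqquotP (VBD n) w1 w2)). Qed.

Lemma diagram_repr n (b : VBD n) : diagram (repr b) = b.
Proof. exact: reprK. Qed.

Definition vbd_one (n : nat) : VBD n := diagram [::].

Definition vbd_mul (n : nat) (b1 b2 : VBD n) : VBD n :=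
  diagram (repr b1 ++ repr b2).

Lemma isotopic_cat n (u1 u2 v1 v2 : word n) :
  isotopic u1 u2 -> isotopic v1 v2 -> isotopic (u1 ++ v1) (u2 ++ v2).
Proof.
move=> /asboolP hu /asboolP hv; apply/asboolP/(rst_trans _ _ _ (u2 ++ v1)).
- elim: hu => [_ _ [u v a b ab]|u|u v _ h|u v w _ h1 _ h2].
  + by rewrite -!catA; apply: rst_step; apply: Exchange.
  + exact: rst_refl.
  + exact: rst_sym.
  + exact: rst_trans h1 h2.
- elim: hv => [_ _ [u v a b ab]|u|u v _ h|u v w _ h1 _ h2].
  + by rewrite !(catA u2); apply: rst_step; apply: Exchange.
  + exact: rst_refl.
  + exact: rst_sym.
  + exact: rst_trans h1 h2.
Qed.

Lemma vbd_mulE n (w1 w2 : word n) :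
  vbd_mul (diagram w1) (diagram w2) = diagram (w1 ++ w2).
Proof.
by apply/diagramP; apply: isotopic_cat; apply/diagramP; rewrite diagram_repr.
Qed.

Lemma vbd_mulA n : associative (@vbd_mul n).
Proof.
move=> a b c; rewrite -(diagram_repr a) -(diagram_repr b) -(diagram_repr c).
by rewrite !vbd_mulE catA.
Qed.

Lemma vbd_mul1 n : left_id (vbd_one n) (@vbd_mul n).
Proof. by move=> a; rewrite -(diagram_repr a) vbd_mulE. Qed.

Lemma vbd_mulr1 n : right_id (vbd_one n) (@vbd_mul n).
Proof. by move=> a; rewrite -(diagram_repr a) vbd_mulE cats0. Qed.

HB.instance Definition _ n :=
  isMonoid.Build (VBD n) (@vbd_mulA n) (@vbd_mul1 n) (@vbd_mulr1 n).

Lemma right_pos_subproof n (i : 'I_n.-1) : (i.+1 < n)%N.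
Proof. by rewrite -ltn_predRL. Qed.

Definition left_pos (n : nat) (i : 'I_n.-1) : 'I_n :=
  widen_ord (leq_pred n) i.

Definition right_pos (n : nat) (i : 'I_n.-1) : 'I_n :=
  Ordinal (right_pos_subproof i).

(* The change of the integer carried by the strand that goes from the right
   position to the left one: this strand is over in a positive crossing and
   under in a negative crossing.  The other strand changes by the opposite. *)
Definition shift (c : crossing) : int :=
  match c with Positive => 1 | Negative => -1 | Virtual => 0 end.

Definition act_letter (n : nat) (x : 'rV[int]_n) (a : letter n) : 'rV[int]_n :=
  \row_j if j == left_pos a.1 then x 0 (right_pos a.1) + shift a.2
         else if j == right_pos a.1 then x 0 (left_pos a.1) - shift a.2
         else x 0 j.

Definition act_word (n : nat) (x : 'rV[int]_n) (w : word n) : 'rV[int]_n :=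
  foldl (@act_letter n) x w.

Definition updown (n : nat) (x : 'rV[int]_n) (b : VBD n) : 'rV[int]_n :=
  act_word x (repr b).

Lemma act_letter_far n (x : 'rV[int]_n) (a b : letter n) : far a b ->
  act_letter (act_letter x a) b = act_letter (act_letter x b) a.
Proof.
move: a b => [a c] [b d]; rewrite /far /= => ab.
apply/rowP => j; rewrite !mxE /= -!val_eqE /=.
have [h1 h2 h3 h4] :
  [/\ (a == b :> nat) = false, (a == b.+1 :> nat) = false,
      (a.+1 == b :> nat) = false & (a.+1 == b.+1 :> nat) = false].
  by case/orP: ab => h; split; apply/eqP => e; move: h;
     rewrite ?eqSS ?e ?ltnn -?e ?ltnn ?ltnNge ?leqW // -ltnS ?e // -?e.
have [g1 g2 g3 g4] :
  [/\ (b == a :> nat) = false, (b == a.+1 :> nat) = false,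
      (b.+1 == a :> nat) = false & (b.+1 == a.+1 :> nat) = false].
  by split; rewrite eq_sym.
rewrite h1 h2 h3 h4 g1 g2 g3 g4.
case: (eqVneq (val j) (val a)) => [->|ja]; first by rewrite h1 h2.
by case: (eqVneq (val j) a.+1) => [->|//]; rewrite h3 h4.
Qed.

Lemma updownE n (x : 'rV[int]_n) (w : word n) :
  updown x (diagram w) = act_word x w.
Proof.
have /diagramP/asboolP h := diagram_repr (diagram w).
rewrite /updown; move: (repr _) h => r.
elim=> {r w} [_ _ [u v a b ab]|//|//|? ? ? _ -> _ -> //].
by rewrite /act_word !foldl_cat /= act_letter_far.
Qed.

Lemma updown1 n (x : 'rV[int]_n) : updown x (1%g : VBD n) = x.
Proof. exact: updownE. Qed.

Lemma updownM n (x : 'rV[int]_n) (b1 b2 : VBD n) :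
  updown x (b1 * b2)%g = updown (updown x b1) b2.
Proof.
rewrite -(diagram_repr b1) -(diagram_repr b2) [(_ * _)%g]vbd_mulE !updownE.
exact: foldl_cat.
Qed.

Local Open Scope classical_set_scope.

Definition updown_set (n : nat) (x : 'rV[int]_n) (N : set (VBD n)) :
  set 'rV[int]_n := [set updown x b | b in N].

Definition has_bigon (n : nat) (w : word n) : Prop :=
  exists (u v : word n) (i : 'I_n.-1),
    w = u ++ [:: (i, Positive); (i, Negative)] ++ v \/
    w = u ++ [:: (i, Negative); (i, Positive)] ++ v.

Definition irreducible (n : nat) (b : VBD n) : Prop :=
  ~ exists2 w : word n, diagram w = b & has_bigon w.

Definition IVBD (n : nat) : set (VBD n) := [set b | irreducible b].

Arguments IVBD : clear implicits.

Definition tr (n : nat) (x : 'rV[int]_n) : int := \sum_(i < n) x 0 i.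

(* Main.v *)
Require Import Defs.
From Stdlib Require Import Relation_Operators.
From mathcomp Require Import all_boot all_order all_algebra.
From mathcomp Require Import boolp classical_sets.

Local Open Scope ring_scope.
Local Open Scope classical_set_scope.

(** Both [sigma_i v_i] and [v_i sigma_i] fix the positions of the strands and
    move one unit between the entries [i] and [i.+1], in opposite directions.
    Words in the letters [sigma_i], [v_i] alone therefore reach every vector of
    the same trace; having no negative crossing, which is invariant under
    isotopy, they represent irreducible diagrams. *)

Import GRing.Theory.

Lemma left_right_pos n (i : 'I_n.-1) : (right_pos i == left_pos i) = false.
Proof. by rewrite -val_eqE /= gtn_eqF. Qed.

(** The two entries involved are swapped and shifted by opposite amounts; the others stay. *)
Lemma tr_act_letter n (x : 'rV[int]_n) a : tr (act_letter x a) = tr x.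
Proof.
rewrite /tr (bigD1 (left_pos a.1)) // (bigD1 (right_pos a.1)) ?left_right_pos //=.
rewrite [RHS](bigD1 (left_pos a.1)) // [in RHS](bigD1 (right_pos a.1)) ?left_right_pos //=.
rewrite !mxE !eqxx left_right_pos addrA [RHS]addrA; congr (_ + _).
  by rewrite addrACA subrr addr0 addrC.
by apply: eq_bigr => j /andP[/negbTE jl /negbTE jr]; rewrite !mxE jl jr.
Qed.

Lemma tr_act_word n (x : 'rV[int]_n) w : tr (act_word x w) = tr x.
Proof.
by elim: w x => //= a w IHw x; rewrite IHw tr_act_letter.
Qed.

(** An exchange only reorders letters, so any condition on the multiset of letters passes to every
    word of a diagram. *)
Lemma isotopic_perm_eq n (w1 w2 : word n) : isotopic w1 w2 -> perm_eq w1 w2.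
Proof.
move=> /asboolP; elim=> {w1 w2} [_ _ [u v a b _]|//|w1 w2 _|w1 w2 w3 _ h _].
- by rewrite perm_cat2l perm_cat2r; apply/permP => p /=; rewrite addnCA.
- by rewrite perm_sym.
- exact: perm_trans.
Qed.

Definition no_negative n (w : word n) := all (fun a => a.2 != Negative) w.

(** A bigon of either kind contains a negative letter. *)
Lemma no_negative_irreducible n (w : word n) :
  no_negative n w -> irreducible (diagram w).
Proof.
move=> wN [w' /diagramP/isotopic_perm_eq ww' bigon].
move: wN; rewrite /no_negative -(perm_all _ ww').
by case: bigon => u [v [i [->|->]]]; rewrite !all_cat /= ?eqxx ?andbF.
Qed.

Definition reachable n (x y : 'rV[int]_n) :=
  exists2 w, no_negative n w & act_word x w = y.

Lemma reachable_refl n x : reachable n x x.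
Proof. by exists [::]. Qed.

Lemma reachable_trans n y x z :
  reachable n x y -> reachable n y z -> reachable n x z.
Proof.
move=> [u uN <-] [v vN <-]; exists (u ++ v).
  by rewrite /no_negative all_cat; apply/andP.
exact: foldl_cat.
Qed.

Lemma tr_reachable n x y : reachable n x y -> tr x = tr y.
Proof. by move=> [w _ <-]; rewrite tr_act_word. Qed.

(** The simple roots of type A, which generate the lattice of trace zero vectors. *)
Definition adjacent_root {n} (i : 'I_n.-1) : 'rV[int]_n :=
  delta_mx 0 (left_pos i) - delta_mx 0 (right_pos i).

Lemma adjacent_rootE n (i : 'I_n.-1) j :
  adjacent_root i 0 j = (j == left_pos i)%:R - (j == right_pos i)%:R.
Proof. by rewrite !mxE. Qed.

Lemma reachable_add1 n x i : reachable n x (x + adjacent_root i).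
Proof.
(* On the two entries: (p, q) -> (q, p) -> (p + 1, q - 1). *)
exists [:: (i, Virtual); (i, Positive)] => //.
apply/rowP => j; rewrite [RHS]mxE adjacent_rootE !mxE /= !eqxx left_right_pos.
case: (eqVneq j (left_pos i)) => [->|_].
  by rewrite (eq_sym (left_pos i)) left_right_pos !subr0.
by case: (eqVneq j (right_pos i)) => [->|_]; rewrite ?addr0 ?sub0r ?oppr0 ?addr0.
Qed.

Lemma reachable_sub1 n x i : reachable n x (x - adjacent_root i).
Proof.
(* On the two entries: (p, q) -> (q + 1, p - 1) -> (p - 1, q + 1). *)
exists [:: (i, Positive); (i, Virtual)] => //.
apply/rowP => j; rewrite [RHS]mxE [(- adjacent_root i) _ _]mxE adjacent_rootE !mxE /=.
rewrite !eqxx left_right_pos opprB.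
case: (eqVneq j (left_pos i)) => [->|_].
  by rewrite (eq_sym (left_pos i)) left_right_pos sub0r addr0.
by case: (eqVneq j (right_pos i)) => [->|_]; rewrite ?subr0 ?addr0.
Qed.

Lemma reachable_add n x i d : reachable n x (x + adjacent_root i *~ d).
Proof.
elim: d => [|k IHk|k IHk]; first by rewrite mulr0z addr0; apply: reachable_refl.
- apply: reachable_trans IHk _; rewrite -(addn1 k) PoszD mulrzDr addrA.
  exact: reachable_add1.
- apply: reachable_trans IHk _; rewrite -(addn1 k) PoszD opprD mulrzDr addrA mulrN1z.
  exact: reachable_sub1.
Qed.

(* The entries are corrected from left to right, the error being pushed to the
   right neighbour. *)
Lemma reachable_prefix m (x y : 'rV[int]_m.+1) k : (k <= m)%N ->
  exists2 z, reachable m.+1 x z & forall j : 'I_m.+1, (j < k)%N -> z 0 j = y 0 j.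
Proof.
elim: k => [|k IHk] km; first by exists x => //; apply: reachable_refl.
have [z xz zy] := IHk (ltnW km).
pose i : 'I_m.+1.-1 := Ordinal km.
(* The coefficient is the error at position [k]; entries before [k] are untouched. *)
exists (z + adjacent_root i *~ (y 0 (left_pos i) - z 0 (left_pos i))).
  by apply: reachable_trans xz _; apply: reachable_add.
move=> j; rewrite ltnS => jk.
rewrite -scaler_int intz [LHS]mxE [(_ *: adjacent_root i) _ _]mxE adjacent_rootE.
have -> : (j == right_pos i) = false by rewrite -val_eqE /= ltn_eqF.
rewrite subr0; case: (eqVneq j (left_pos i)) => [->|jl].
  by rewrite mulr1 addrC subrK.
by rewrite mulr0 addr0 zy // ltn_neqAle jk andbT; move: jl; rewrite -val_eqE.
Qed.

Lemma reachable_tr n (x y : 'rV[int]_n) : tr x = tr y -> reachable n x y.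
Proof.
case: n x y => [|m] x y xy.
  by rewrite (_ : y = x); [apply: reachable_refl | apply/rowP => -[]].
(* All entries but the last now agree with [y]; equality of traces forces the last one. *)
have [z xz zy] := reachable_prefix m x y m (leqnn m).
suff <- : z = y by [].
have zyw (j : 'I_m) : z 0 (widen_ord (leqnSn m) j) = y 0 (widen_ord (leqnSn m) j).
  by apply: zy => /=; apply: ltn_ord.
apply/rowP => j; case: (ltnP j m) => [/zy //|mj].
have -> : j = ord_max by apply/val_inj/eqP; rewrite eqn_leq mj -ltnS ltn_ord.
have := etrans (esym (tr_reachable _ _ _ xz)) xy.
by rewrite /tr !big_ord_recr /= (eq_bigr _ (fun j _ => zyw j)) => /addrI.
Qed.

Theorem theorem1p2 (n : nat) (hn : (0 < n)%N) (x : 'rV[int]_n) :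
  updown_set x [set: VBD n] = [set y : 'rV[int]_n | tr x = tr y] /\
  updown_set x (IVBD n) = updown_set x [set: VBD n].
Proof.
have tr_updown b : tr x = tr (updown x b) by rewrite tr_act_word.
(* Realizing [y] by an irreducible diagram at once gives the nontrivial inclusion of both
   equalities. *)
have realize y : tr x = tr y -> updown_set x (IVBD n) y.
  move=> /reachable_tr[w wN <-]; exists (diagram w); last exact: updownE.
  exact: no_negative_irreducible.
split; apply/seteqP; split => y /=.
- by case=> b _ <-.
- by move=> /realize[b _ <-]; exists b.
- by case=> b _ <-; exists b.
- by case=> b _ <-; apply: realize.
Qed.
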